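(* Let $d,m,N,\mathsf{K}$ be positive integers, $A\in\mathbb{R}^{d\times d}$, $B\in\mathbb{R}^{d\times m}$, and consider $x_{t+1}=Ax_t+Bu_t$ with $x_0\sim\mathrm{GMM}(\{\alpha_i,\mu_0^i,\Sigma_0^i\}_{i=0}^{\mathsf{K}-1})$. Let $v_t^i\in\mathbb{R}^m$ and $K_t^i\in\mathbb{R}^{m\times d}$ be given, let $\mu_t^i\in\mathbb{R}^d$, $\Sigma_t^i\in\mathbb{R}^{d\times d}$ be defined by the dynamics $$\mu_{t+1}^i=A\mu_t^i+Bv_t^i,\qquad \Sigma_{t+1}^i=(A+BK_t^i)\Sigma_t^i(A+BK_t^i)^\top,$$ and suppose $\Sigma_t^i$ is positive definite for all $i\in\{0,\dots,\mathsf{K}-1\}$, $t\in\{0,\dots,N-1\}$. Let $u_t$ be generated by the randomized affine policy $$u_t=v_t^i+K_t^i(x_t-\mu_t^i)\quad\text{with probability }\gamma_i(x_t)=\frac{\alpha_i\,p_{\mathcal N}(x_t;\mu_t^i,\Sigma_t^i)}{\sum_{l=0}^{\mathsf{K}-1}\alpha_l\,p_{\mathcal N}(x_t;\mu_t^l,\Sigma_t^l)},\quad i\in\{0,\dots,\mathsf{K}-1\}.$$ Then $x_t\sim\mathrm{GMM}(\{\alpha_i,\mu_t^i,\Sigma_t^i\}_{i=0}^{\mathsf{K}-1})$ for all $t\in\{0,\dots,N-1\}$.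
   Context: $\mathrm{GMM}(\{\alpha_i,\mu^i,\Sigma^i\}_{i=0}^{\mathsf{K}-1})$ denotes the Gaussian mixture distribution $\sum_i\alpha_i\,\mathcal{N}(\mu^i,\Sigma^i)$ with weights $\alpha_i\ge0$, $\sum_i\alpha_i=1$. $p_{\mathcal N}(\cdot;\mu,\Sigma)$ is the density of $\mathcal{N}(\mu,\Sigma)$. The policy means: at each time $t$, conditionally on $x_t$ (and the past), an index $i$ is drawn with probability $\gamma_i(x_t)$ depending only on $x_t$, and then $u_t=v_t^i+K_t^i(x_t-\mu_t^i)$; so the conditional law of $u_t$ given $x_t=\hat x$ is $\sum_i\gamma_i(\hat x)\,\delta_{v_t^i+K_t^i(\hat x-\mu_t^i)}$. *)

(* Defs.v *)
From HB Require Import structures.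
From mathcomp Require Import all_boot all_order all_algebra.
From mathcomp Require Import all_classical all_reals all_analysis.

Set Implicit Arguments.
Unset Strict Implicit.
Unset Printing Implicit Defensive.

Import Order.TTheory GRing.Theory Num.Theory.
Import numFieldNormedType.Exports.

Local Open Scope classical_set_scope.
Local Open Scope ring_scope.

(* Vectors of R^n are column matrices 'cV[R]_n. Matrices carry the sigma-algebra
   generated by the coordinate maps (the product sigma-algebra, as the library
   does for tuples); over R^n it is the Borel sigma-algebra. *)
Section matrix_measurable.
Context (R : realType) (m n : nat).

Definition mx_cylinder : set (set 'M[R]_(m, n)) :=
  [set A | exists i j (B : set R),
     measurable B /\ A = (fun M : 'M[R]_(m, n) => M i j) @^-1` B].

Let mx_set0 : <<s mx_cylinder >> set0.
Proof. exact: sigma_algebra0. Qed.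

Let mx_setC A : <<s mx_cylinder >> A -> <<s mx_cylinder >> (~` A).
Proof. exact: sigma_algebraC. Qed.

Let mx_bigcup (F : (set 'M[R]_(m, n))^nat) :
  (forall i, <<s mx_cylinder >> (F i)) -> <<s mx_cylinder >> (\bigcup_i F i).
Proof. exact: sigma_algebra_bigcup. Qed.

HB.instance Definition _ := @isMeasurable.Build default_measure_display
  'M[R]_(m, n) <<s mx_cylinder >> mx_set0 mx_setC mx_bigcup.

End matrix_measurable.

Section lebesgue_cV.
Context (R : realType).

Lemma mk_sigma_finite d (T : measurableType d) (lam : set T -> \bar R) :
  lam set0 = 0%E -> (forall A, 0 <= lam A)%E -> semi_sigma_additive lam ->
  sigma_finite setT lam ->
  {mu : {sigma_finite_measure set T -> \bar R} | mu = lam :> (set _ -> _)}.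
Proof.
move=> lam0 lam_ge0 lam_sa lam_sf.
pose M := isMeasure.Build _ _ _ lam lam0 lam_ge0 lam_sa.
pose lamM : {measure set T -> \bar R} := HB.pack lam M.
pose S := Measure_isSigmaFinite.Build _ _ _ lamM lam_sf.
pose lamS : {sigma_finite_measure set T -> \bar R} := HB.pack lam M S.
by exists lamS.
Qed.

Lemma sigma_finite_pushforward d1 d2 (T1 : measurableType d1)
    (T2 : measurableType d2) (f : T1 -> T2) (g : T2 -> T1)
    (nu : {measure set T1 -> \bar R}) :
  sigma_finite setT nu ->
  measurable_fun setT f -> measurable_fun setT g -> cancel f g ->
  {mu : {sigma_finite_measure set T2 -> \bar R}
    | mu = pushforward nu f :> (set _ -> _)}.
Proof.
move=> nu_sf mf mg fK.
pose lam := pushforward nu f.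
have lam0 : lam set0 = 0%E by rewrite /lam /pushforward preimage_set0 measure0.
have lam_ge0 A : (0 <= lam A)%E by exact: measure_ge0.
have lam_sa : semi_sigma_additive lam.
  move=> F mF tF mUF; rewrite /lam /pushforward preimage_bigcup.
  apply: measure_semi_sigma_additive.
  - by move=> k; rewrite -[X in measurable X]setTI; exact: mf.
  - apply/trivIsetP => /= i j _ _ ij; rewrite -preimage_setI.
    by move/trivIsetP : tF => /(_ _ _ _ _ ij) ->//; rewrite preimage_set0.
  - by rewrite -preimage_bigcup -[X in measurable X]setTI; exact: mf.
have lam_sf : sigma_finite setT lam.
  have [F UF mF] := nu_sf.
  exists (fun k => g @^-1` F k).
    by rewrite -preimage_bigcup -UF preimage_setT.
  move=> k; have [mFk nuF] := mF k; split.
    by rewrite -[X in measurable X]setTI; exact: mg.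
  rewrite /lam /pushforward -comp_preimage (_ : g \o f = id) ?preimage_id//.
  exact/funext.
exact: mk_sigma_finite.
Qed.

Definition cons_cV n (p : measurableTypeR R * 'cV[R]_n) : 'cV[R]_n.+1 :=
  col_mx (p.1%:M : 'cV[R]_1) p.2.

(* n-dimensional Lebesgue measure: the n-fold product of the one-dimensional
   one, transported to column vectors. *)
Fixpoint lebesgue_cV n : set 'cV[R]_n -> \bar R :=
  match n with
  | 0 => dirac (0 : 'cV[R]_0)
  | n'.+1 => pushforward (lebesgue_measure \x @lebesgue_cV n')%E (@cons_cV n')
  end.

Lemma measurable_mx_coord m n (i : 'I_m) (j : 'I_n) :
  measurable_fun setT (fun M : 'M[R]_(m, n) => M i j).
Proof.
move=> _ B mB; rewrite setTI; apply: sub_sigma_algebra.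
by exists i, j, B.
Qed.

Lemma measurable_fun_mxP d (T : measurableType d) m n (f : T -> 'M[R]_(m, n)) :
  (forall i j, measurable_fun setT (fun x => f x i j)) -> measurable_fun setT f.
Proof.
move=> mf; apply: (@measurability _ _ _ _ _ _ (@mx_cylinder R m n)) => //.
by move=> _ [_ [i [j [B [mB ->]]]] <-]; exact: mf.
Qed.

Lemma measurable_cons_cV n : measurable_fun setT (@cons_cV n).
Proof.
apply: measurable_fun_mxP => i j.
have -> : j = ord0 by apply/val_inj; case: j => -[].
case: (splitP (i : 'I_(1 + n))) => [i0 ii0|k ik].
  rewrite (_ : (fun x => _) = fst); first exact: measurable_fst.
  apply/funext => p; rewrite /cons_cV.
  have -> : i = lshift n i0 by apply/val_inj.
  apply: etrans (col_mxEu _ _ i0 ord0) _.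
  by rewrite mxE !ord1 eqxx.
rewrite (_ : (fun x => _) = (fun v : 'cV[R]_n => v k ord0) \o snd).
  by apply: measurableT_comp => //; exact: measurable_mx_coord.
apply/funext => p; rewrite /cons_cV/=.
have -> : i = rshift 1 k by apply/val_inj.
exact: (col_mxEd _ _ k ord0).
Qed.

Lemma sigma_finite_product d1 d2 (T1 : measurableType d1)
    (T2 : measurableType d2) (m1 : {sigma_finite_measure set T1 -> \bar R})
    (m2 : {sigma_finite_measure set T2 -> \bar R}) :
  sigma_finite setT (m1 \x m2)%E.
Proof.
have /sigma_finiteP[F [TF ndF Foo]] := sigma_finiteT m1.
have /sigma_finiteP[G [TG ndG Goo]] := sigma_finiteT m2.
exists (fun n => F n `*` G n).
  rewrite -setXTT TF TG predeqE => -[x y]; split.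
    move=> [/= [n _ Fnx] [k _ Gky]]; exists (maxn n k) => //; split.
    - by move: x Fnx; exact/subsetPset/ndF/leq_maxl.
    - by move: y Gky; exact/subsetPset/ndG/leq_maxr.
  by move=> [n _ []/= ? ?]; split; exists n.
move=> k; have [? ?] := Foo k; have [? ?] := Goo k.
split; first exact: measurableX.
by rewrite product_measure1E// lte_mul_pinfty// ge0_fin_numE.
Qed.

Lemma lebesgue_cV_subproof n :
  {mu : {sigma_finite_measure set 'cV[R]_n -> \bar R}
    | mu = @lebesgue_cV n :> (set _ -> _)}.
Proof.
elim: n => [|n [mu muE]] /=.
  by exists (dirac (0 : 'cV[R]_0)).
rewrite -muE.
pose h (v : 'cV[R]_n.+1) : measurableTypeR R * 'cV[R]_n :=
  (v ord0 ord0, dsubmx (v : 'cV[R]_(1 + n))).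
apply: (@sigma_finite_pushforward _ _ _ _ _ h); last first.
- case=> a v; rewrite /h /cons_cV col_mxKd/=; congr pair.
  rewrite (_ : ord0 = lshift n (ord0 : 'I_1)); last exact/val_inj.
  by apply: etrans (col_mxEu _ _ ord0 ord0) _; rewrite mxE eqxx.
- apply/measurable_fun_pair => /=; first exact: measurable_mx_coord.
  apply: measurable_fun_mxP => i j.
  rewrite (_ : (fun x => _) = fun v : 'cV[R]_n.+1 => v (rshift 1 i) j).
    exact: measurable_mx_coord.
  by apply/funext => v; rewrite mxE.
- exact: measurable_cons_cV.
- exact: sigma_finite_product.
Qed.

Let lebesgue_cV0 n : @lebesgue_cV n set0 = 0%E.
Proof. by case: (lebesgue_cV_subproof n) => mu <-; exact: measure0. Qed.

Let lebesgue_cV_ge0 n A : (0 <= @lebesgue_cV n A)%E.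
Proof. by case: (lebesgue_cV_subproof n) => mu <-; exact: measure_ge0. Qed.

Let lebesgue_cV_sigma_additive n : semi_sigma_additive (@lebesgue_cV n).
Proof.
by case: (lebesgue_cV_subproof n) => mu <-; exact: measure_semi_sigma_additive.
Qed.

HB.instance Definition _ n := isMeasure.Build _ _ _ (@lebesgue_cV n)
  (lebesgue_cV0 n) (@lebesgue_cV_ge0 n) (@lebesgue_cV_sigma_additive n).

Let lebesgue_cV_sigma_finite n : sigma_finite setT (@lebesgue_cV n).
Proof. by case: (lebesgue_cV_subproof n) => mu <-; exact: sigma_finiteT. Qed.

HB.instance Definition _ n := Measure_isSigmaFinite.Build _ _ _ (@lebesgue_cV n)
  (@lebesgue_cV_sigma_finite n).

End lebesgue_cV.
Arguments lebesgue_cV {R} n.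

Definition posdefmx (R : realType) n (S : 'M[R]_n) : Prop :=
  S^T = S /\ forall z : 'cV[R]_n, z != 0 -> 0 < (z^T *m S *m z) 0 0.

Section gaussian_mixture.
Context (R : realType) (n : nat).
Implicit Types (mu z : 'cV[R]_n) (S : 'M[R]_n) (A : set 'cV[R]_n).

Definition gauss_pdf mu S z : R :=
  (Num.sqrt ((2 * pi) ^+ n * \det S))^-1 *
  expR (- ((z - mu)^T *m invmx S *m (z - mu)) 0 0 / 2).

(* Only meaningful for a positive definite covariance S. *)
Definition gauss_law mu S A : \bar R :=
  (\int[lebesgue_cV n]_(z in A) (gauss_pdf mu S z)%:E)%E.

Definition gmm k (alpha : 'I_k -> R) (mu : 'I_k -> 'cV[R]_n)
    (S : 'I_k -> 'M[R]_n) A : \bar R :=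
  (\sum_(i < k) (alpha i)%:E * gauss_law (mu i) (S i) A)%E.

Definition gmm_posterior k (alpha : 'I_k -> R) (mu : 'I_k -> 'cV[R]_n)
    (S : 'I_k -> 'M[R]_n) (i : 'I_k) z : R :=
  alpha i * gauss_pdf (mu i) (S i) z /
  \sum_(l < k) alpha l * gauss_pdf (mu l) (S l) z.

End gaussian_mixture.

Definition has_law (R : realType) dO (Omega : measurableType dO)
    (P : probability Omega R) dT (T : measurableType dT)
    (X : {RV P >-> T}) (law : set T -> \bar R) : Prop :=
  forall A, measurable A -> distribution P X A = law A.

(* f is a version of the conditional probability P(E | G), for a sub-sigma-algebra
   G of the events. *)
Definition is_cond_prob (R : realType) dO (Omega : measurableType dO)
    (P : probability Omega R) (G : set (set Omega)) (E : set Omega)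
    (f : Omega -> R) : Prop :=
  (forall B : set R, measurable B -> G (f @^-1` B)) /\
  (forall H, G H -> P (H `&` E) = (\int[P]_(w in H) (f w)%:E)%E).

(* The sigma-algebra generated by x_0, ..., x_t and u_0, ..., u_(t-1). *)
Definition history Omega dX (X : measurableType dX) dU (U : measurableType dU)
    (x : nat -> Omega -> X) (u : nat -> Omega -> U) (t : nat) :
    set (set Omega) :=
  <<s [set E | (exists s B, [/\ (s <= t)%N, measurable B & E = x s @^-1` B]) \/
               (exists s B, [/\ (s < t)%N, measurable B & E = u s @^-1` B])] >>.

(* Main.v *)
Require Import Defs.
From HB Require Import structures.
From mathcomp Require Import all_boot all_order all_algebra.
From mathcomp Require Import all_classical all_reals all_analysis.
From mathcomp Require Import measurable_realfun measurable_fun_approximation.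
From mathcomp Require Import ring.

Set Implicit Arguments.
Unset Strict Implicit.
Unset Printing Implicit Defensive.

Import Order.TTheory GRing.Theory Num.Theory.
Import numFieldNormedType.Exports.

Local Open Scope classical_set_scope.
Local Open Scope ring_scope.

(* On {idx_t = i} the next state is the affine image M_i x_t + b_i with
   M_i = A + B K_i, so P(x_(t+1) in E) splits as the sum over i of
   P(x_t in C_i, idx_t = i), where C_i is the preimage of E. Conditioning on the
   history and inserting the inductive law of x_t, the mixture density cancels
   the denominator of the posterior, and each summand is alpha_i times the i-th
   Gaussian mass of C_i. The affine change of variables turns this into the mass
   of E under the pushed-forward Gaussian; M_i is invertible because
   M_i Sigma_t M_i^T = Sigma_(t+1) is positive definite.

   The change of variables in R^(n+1) = R x R^n is proved by induction on n with
   Tonelli: a matrix with nonzero upper-left entry factors, through its Schur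
   complement, as shear * block-diagonal * shear, and any other invertible
   matrix becomes one of these after one more shear. *)

(** * Affine change of variables for Lebesgue measure on column vectors *)

Section affine_change_of_variables.
Context {R : realType}.
Implicit Type n : nat.

Lemma measurable_affine1 (c b : R) :
  measurable_fun setT
    (fun a : measurableTypeR R => c * a + b : measurableTypeR R).
Proof. by apply: measurable_funD => //; exact: measurable_funM. Qed.

(** Lebesgue measure is determined by its values on half-open intervals, and the right-hand side is
    a measure with the same values there. *)
Lemma lebesgue_measure_affine (c b : R) (A : set (measurableTypeR R)) :
  c != 0 -> measurable A ->
  (lebesgue_measure A =
   `|c|%:E * pushforward lebesgue_measure
     (fun a : measurableTypeR R => (c * a + b)%R : measurableTypeR R) A)%E.
Proof.
move=> c0 mA; pose h (a : measurableTypeR R) : measurableTypeR R := c * a + b.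
have mh : measurable_fun setT h by exact: measurable_affine1.
(* The measure structure on a pushforward depends on the measurability proof of
   the map, so that nu is a function of such a proof. *)
pose nu := mscale (NngNum (normr_ge0 c)) (pushforward lebesgue_measure h).
transitivity (nu mh A); last by [].
apply: lebesgue_measure_unique => //= _ [[x y] _ <-].
rewrite /nu /mscale/= /pushforward.
have [cgt|clt|c00] := ltgtP 0 c; last by rewrite -c00 eqxx in c0.
- rewrite (_ : h @^-1` _ = `](x - b) / c, (y - b) / c]%classic); last first.
    apply/seteqP; split => a /=;
    rewrite /h !in_itv/= ltr_pdivrMr// ler_pdivlMr//;
    by rewrite ltrBlDr lerBrDr mulrC.
  rewrite !lebesgue_measure_itv/= !lte_fin ltr_pM2r ?invr_gt0// ltrD2r.
  case: ifP => _; last by rewrite mule0.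
  by rewrite -!EFinB -EFinM gtr0_norm//; congr EFin; field; rewrite gt_eqF.
(* For negative [c] the preimage is reversed: its left end is closed and its right end open. *)
- rewrite (_ : h @^-1` _ = `[(y - b) / c, (x - b) / c[%classic); last first.
    apply/seteqP; split => a /=;
    rewrite /h !in_itv/= ltr_ndivlMr// ler_ndivrMr//;
    by rewrite ltrBlDr lerBrDr [a * c]mulrC andbC.
  rewrite !lebesgue_measure_itv/= !lte_fin ltr_nM2r ?invr_lt0// ltrD2r.
  case: ifP => _; last by rewrite mule0.
  by rewrite -!EFinB -EFinM ltr0_norm//; congr EFin; field; rewrite lt_eqF.
Qed.

Lemma ge0_integral_affine1 (c b : R) (f : R -> \bar R) :
  c != 0 -> measurable_fun setT f -> (forall x, 0 <= f x)%E ->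
  (\int[lebesgue_measure]_x f x =
   `|c|%:E * \int[lebesgue_measure]_x f (c * x + b)%R)%E.
Proof.
move=> c0 mf f0.
pose h (a : measurableTypeR R) : measurableTypeR R := c * a + b.
have mh : measurable_fun setT h by exact: measurable_affine1.
pose nu := mscale (NngNum (normr_ge0 c)) (pushforward lebesgue_measure h).
transitivity (\int[nu mh]_x f x)%E.
  by apply: eq_measure_integral => A mA _; exact: lebesgue_measure_affine.
by rewrite ge0_integral_mscale//= ge0_integral_pushforward.
Qed.

Lemma measurable_fun_cons_cV d (T : measurableType d) n (f : T -> R)
    (g : T -> 'cV[R]_n) :
  measurable_fun setT f -> measurable_fun setT g ->
  measurable_fun setT (fun x => cons_cV (f x : measurableTypeR R, g x)).
Proof.
move=> mf mg.
apply: (measurableT_comp (@measurable_cons_cV R n)).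
exact/measurable_fun_pair.
Qed.

Lemma ge0_integral_lebesgue_cVS n (f : 'cV[R]_n.+1 -> \bar R) :
  measurable_fun setT f -> (forall x, 0 <= f x)%E ->
  (\int[lebesgue_cV n.+1]_x f x =
   \int[lebesgue_measure]_a \int[lebesgue_cV n]_v f (cons_cV (a, v)))%E.
Proof.
move=> mf f0.
have mfc : measurable_fun setT (f \o @cons_cV R n).
  by apply: measurableT_comp => //; exact: measurable_cons_cV.
rewrite -(fubini_tonelli1 _ mfc (fun=> f0 _)).
have -> : @lebesgue_cV R n.+1 =
  pushforward (lebesgue_measure \x lebesgue_cV n)%E (@cons_cV R n) by [].
by rewrite ge0_integral_pushforward//; exact: measurable_cons_cV.
Qed.

(** An upper shear moves only the first coordinate, so its treatment needs the inner integral to run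
    over that coordinate. *)
Lemma ge0_integral_lebesgue_cVS_swap n (f : 'cV[R]_n.+1 -> \bar R) :
  measurable_fun setT f -> (forall x, 0 <= f x)%E ->
  (\int[lebesgue_cV n.+1]_x f x =
   \int[lebesgue_cV n]_v \int[lebesgue_measure]_a f (cons_cV (a, v)))%E.
Proof.
move=> mf f0; rewrite ge0_integral_lebesgue_cVS//.
have mfc : measurable_fun setT (f \o @cons_cV R n).
  by apply: measurableT_comp => //; exact: measurable_cons_cV.
exact: (fubini_tonelli _ mfc (fun=> f0 _)).
Qed.

Lemma measurable_affine m n (M : 'M[R]_(m, n)) (b : 'cV[R]_m) :
  measurable_fun setT (fun x : 'cV[R]_n => M *m x + b).
Proof.
apply: measurable_fun_mxP => i j.
under eq_fun do rewrite mxE.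
apply: measurable_funD => //.
under eq_fun do rewrite mxE.
apply: measurable_sum => l; apply: measurable_funM => //.
exact: measurable_mx_coord.
Qed.

(** Quantifying over nonnegative functions instead of sets allows the formula to be applied to the
    inner integral in Tonelli. *)
Definition affine_change n (M : 'M[R]_n) (b : 'cV[R]_n) : Prop :=
  forall f : 'cV[R]_n -> \bar R,
    measurable_fun setT f -> (forall x, 0 <= f x)%E ->
    (\int[lebesgue_cV n]_x f x =
     `|\det M|%:E * \int[lebesgue_cV n]_x f (M *m x + b)%R)%E.

Lemma affine_change_comp n (M1 M2 : 'M[R]_n) (b1 b2 : 'cV[R]_n) :
  affine_change M1 b1 -> affine_change M2 b2 ->
  affine_change (M1 *m M2) (M1 *m b2 + b1).
Proof.
move=> H1 H2 f mf f0; rewrite H1// H2//; last first.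
  by apply: measurableT_comp => //; exact: measurable_affine.
rewrite det_mulmx normrM EFinM muleA; congr (_ * _)%E.
by apply: eq_integral => x _; rewrite mulmxDr mulmxA addrA.
Qed.

Lemma mul_block_cons_cV n (c : R) (r : 'rV[R]_n) (w : 'cV[R]_n) (D : 'M[R]_n)
    (p : measurableTypeR R * 'cV[R]_n) :
  (block_mx (c%:M : 'M[R]_1) r w D : 'M[R]_n.+1) *m cons_cV p =
  cons_cV (c * p.1 + (r *m p.2) 0 0 : measurableTypeR R,
           w *m (p.1%:M : 'M[R]_1) + D *m p.2).
Proof.
apply: etrans (@mul_block_col R 1 n 1 n 1 _ _ _ _ _ _) _; rewrite /cons_cV/=.
congr col_mx; rewrite -scalar_mxM [X in _ + X]mx11_scalar.
by rewrite raddfD.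
Qed.

Lemma det_ublock1 n (c : R) (r : 'rV[R]_n) (D : 'M[R]_n) :
  \det (block_mx (c%:M : 'M[R]_1) r 0 D : 'M[R]_n.+1) = c * \det D.
Proof. by have := @det_ublock R 1 n c%:M r D; rewrite det_scalar1. Qed.

Lemma det_lblock1 n (c : R) (w : 'cV[R]_n) (D : 'M[R]_n) :
  \det (block_mx (c%:M : 'M[R]_1) 0 w D : 'M[R]_n.+1) = c * \det D.
Proof. by have := @det_lblock R 1 n c%:M w D; rewrite det_scalar1. Qed.

Lemma measurable_integral_cons_cV n (f : 'cV[R]_n.+1 -> \bar R) :
  measurable_fun setT f -> (forall x, 0 <= f x)%E ->
  measurable_fun setT
    (fun a : R =>
       \int[lebesgue_cV n]_v f (cons_cV (a : measurableTypeR R, v)))%E.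
Proof.
move=> mf f0; have mfc := measurableT_comp mf (@measurable_cons_cV R n).
exact: (measurable_fun_fubini_tonelli_F _ mfc (fun=> f0 _)).
Qed.

(** Tonelli separates the blocks: the one-dimensional formula acts on the outer integral and the
    hypothesis on [N] on each inner one. *)
Lemma affine_change_diag n (c b : R) (N : 'M[R]_n) (b' : 'cV[R]_n) :
  c != 0 -> affine_change N b' ->
  affine_change (block_mx (c%:M : 'M[R]_1) 0 0 N : 'M[R]_n.+1)
    (cons_cV (b : measurableTypeR R, b')).
Proof.
move=> c0 HN f mf f0.
have mfb a :
    measurable_fun setT (fun v => f (cons_cV (a : measurableTypeR R, v))).
  by apply: measurableT_comp => //; exact: measurable_fun_cons_cV.
rewrite ge0_integral_lebesgue_cVS// (ge0_integral_affine1 b c0)//; last 2 first.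
- exact: measurable_integral_cons_cV.
- by move=> a; exact: integral_ge0.
rewrite det_ublock1 normrM EFinM -muleA; congr (_ * _)%E.
have mg : measurable_fun setT
    (fun x => f ((block_mx (c%:M : 'M[R]_1) 0 0 N : 'M[R]_n.+1) *m x +
                 cons_cV (b : measurableTypeR R, b'))).
  by apply: measurableT_comp => //; exact: measurable_affine.
rewrite [in RHS]ge0_integral_lebesgue_cVS//.
rewrite -ge0_integralZl//; last 2 first.
- exact: (measurable_integral_cons_cV mg (fun=> f0 _)).
- by move=> a _; exact: integral_ge0.
apply: eq_integral => a _; rewrite HN//.
congr (_ * _)%E; apply: eq_integral => x _.
rewrite mul_block_cons_cV /= mul0mx mul0mx add0r mxE addr0.
congr (f _); apply/esym/(etrans (@add_col_mx R 1 n 1 _ _ _ _)).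
by rewrite /cons_cV/= -raddfD.
Qed.

(** Once the first coordinate is fixed at [a], the shear translates the others by [a] times [w], so
    translation invariance in dimension [n] suffices. *)
Lemma affine_change_lshear n (w : 'cV[R]_n) :
  (forall b : 'cV[R]_n, affine_change 1%:M b) ->
  affine_change (block_mx (1%:M : 'M[R]_1) 0 w 1%:M : 'M[R]_n.+1) 0.
Proof.
move=> H f mf f0; rewrite det_lblock1 mul1r det1 normr1 mul1e.
have mfb a :
    measurable_fun setT (fun v => f (cons_cV (a : measurableTypeR R, v))).
  by apply: measurableT_comp => //; exact: measurable_fun_cons_cV.
set M := block_mx _ _ _ _.
have mg : measurable_fun setT (fun x => f (M *m x + 0)).
  by apply: measurableT_comp => //; exact: measurable_affine.
rewrite (ge0_integral_lebesgue_cVS mf f0).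
rewrite (ge0_integral_lebesgue_cVS mg (fun=> f0 _)).
apply: eq_integral => a _; rewrite (H (w *m (a%:M : 'M[R]_1)))//.
rewrite det1 normr1 mul1e; apply: eq_integral => x _.
by rewrite mul_block_cons_cV /= mul0mx mxE !addr0 !mul1r mul1mx [_ + x]addrC.
Qed.

(** Once the last coordinates are fixed at [v], the shear translates the first one by [r *m v], a
    one-dimensional change of variables. *)
Lemma affine_change_ushear n (r : 'rV[R]_n) :
  affine_change (block_mx (1%:M : 'M[R]_1) r 0 1%:M : 'M[R]_n.+1) 0.
Proof.
move=> f mf f0; rewrite det_ublock1 mul1r det1 normr1 mul1e.
set M := block_mx _ _ _ _.
have mg : measurable_fun setT (fun x => f (M *m x + 0)).
  by apply: measurableT_comp => //; exact: measurable_affine.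
rewrite (ge0_integral_lebesgue_cVS_swap mf f0).
rewrite (ge0_integral_lebesgue_cVS_swap mg (fun=> f0 _)).
have mfb v :
    measurable_fun setT (fun a : measurableTypeR R => f (cons_cV (a, v))).
  by apply: measurableT_comp => //; exact: measurable_fun_cons_cV.
apply: eq_integral => v _.
rewrite (@ge0_integral_affine1 1 ((r *m v) 0 0))//; last exact: mfb.
rewrite normr1 mul1e; apply: eq_integral => a _.
by rewrite mul_block_cons_cV /= mul0mx add0r addr0 mul1mx.
Qed.

Lemma mul_block1 n (c c' : R) (r r' : 'rV[R]_n) (w w' : 'cV[R]_n)
    (D D' : 'M[R]_n) :
  (block_mx (c%:M : 'M[R]_1) r w D : 'M[R]_n.+1) *m
  (block_mx (c'%:M : 'M[R]_1) r' w' D' : 'M[R]_n.+1) =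
  block_mx ((c * c' + (r *m w') 0 0)%:M : 'M[R]_1) (c *: r' + r *m D')
    (c' *: w + D *m w') (w *m r' + D *m D') :> 'M[R]_n.+1.
Proof.
apply: etrans (@mulmx_block R 1 n 1 n 1 n _ _ _ _ _ _ _ _) _.
by rewrite -scalar_mxM mul_scalar_mx mul_mx_scalar raddfD /= -mx11_scalar.
Qed.

(** Block Gaussian elimination: [N] is the Schur complement of [c]. The middle factor has
    determinant [c * \det N], so [N] is invertible and [IH] applies to it. *)
Lemma affine_change_pivot n (c : R) (r : 'rV[R]_n) (w : 'cV[R]_n)
    (D : 'M[R]_n) :
  (forall (N : 'M[R]_n) b, N \in unitmx -> affine_change N b) ->
  c != 0 -> (block_mx (c%:M : 'M[R]_1) r w D : 'M[R]_n.+1) \in unitmx ->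
  affine_change (block_mx (c%:M : 'M[R]_1) r w D : 'M[R]_n.+1) 0.
Proof.
move=> IH c0; pose N := D - (c^-1 *: w) *m r.
have -> : (block_mx (c%:M : 'M[R]_1) r w D : 'M[R]_n.+1) =
    block_mx (1%:M : 'M[R]_1) 0 (c^-1 *: w) 1%:M *m
    (block_mx (c%:M : 'M[R]_1) 0 0 N *m
     block_mx (1%:M : 'M[R]_1) (c^-1 *: r) 0 1%:M).
  have e0 : (0 : 'M[R]_1) 0 0 = 0 by rewrite mxE.
  rewrite !mul_block1 !(mul0mx, mulmx0, e0, addr0, add0r) !(mul1r, mulr1).
  rewrite !(mul1mx, mulmx1, scaler0, scale1r, scale0r, addr0, add0r).
  by rewrite !scalerA divff// !scale1r addrC subrK.
rewrite !unitmx_mul => /and3P[_ uDN _].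
have uN : N \in unitmx.
  by move: uDN; rewrite !unitmxE det_ublock1 unitrM => /andP[].
have Hd := affine_change_diag 0 c0 (IH N 0 uN).
have c00 : cons_cV (0 : measurableTypeR R, 0 : 'cV[R]_n) = 0.
  by rewrite /cons_cV/= raddf0; exact: (@col_mx0 R 1 n 1).
rewrite c00 in Hd.
have := affine_change_comp Hd (affine_change_ushear (c^-1 *: r)).
rewrite mulmx0 addr0 => H.
have := affine_change_comp (affine_change_lshear (c^-1 *: w) _) H.
by rewrite mulmx0 addr0; apply => b; apply: IH; exact: unitmx1.
Qed.

Lemma affine_change_unitmx n (M : 'M[R]_n) (b : 'cV[R]_n) :
  M \in unitmx -> affine_change M b.
Proof.
elim: n M b => [M b _ f mf f0|n IH M b uM].
  rewrite det_mx00 normr1 mul1e; apply: eq_integral => x _.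
  by congr f; apply/matrixP => -[].
(* Translation by [b] is block diagonal with identity blocks; composing it after [M] recovers the
   general case. *)
suff {b} H : affine_change M 0.
  have H1 : affine_change 1%:M b.
    have := @affine_change_diag n 1 (b ord0 ord0) 1%:M
      (dsubmx (b : 'cV[R]_(1 + n))) (oner_neq0 R) (IH _ _ (unitmx1 _ _)).
    rewrite (_ : cons_cV _ = b); last first.
      rewrite -[RHS](@vsubmxK R 1 n 1); apply: congr2 => //=.
      rewrite [RHS]mx11_scalar mxE; congr (b _ _)%:M; exact/val_inj.
    rewrite (_ : block_mx _ _ _ _ = 1%:M)//.
    exact/esym/(@scalar_mx_block R 1 n).
  by have := affine_change_comp H1 H; rewrite mul1mx mul1mx add0r.
pose c := (M : 'M[R]_(1 + n)) ord0 ord0.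
pose r := ursubmx (M : 'M[R]_(1 + n)).
pose w := dlsubmx (M : 'M[R]_(1 + n)).
pose D := drsubmx (M : 'M[R]_(1 + n)).
have ME : M = (block_mx (c%:M : 'M[R]_1) r w D : 'M[R]_n.+1).
  apply: (etrans (esym (@submxK R 1 n 1 n M))); congr block_mx.
  rewrite [LHS]mx11_scalar !mxE; congr (_%:M); rewrite /c; congr (M _ _);
  exact/val_inj.
rewrite ME in uM *.
have [c0|] := eqVneq c 0; last by move=> c0; exact: affine_change_pivot.
(* With a zero pivot, a zero column [w] below it would make the determinant vanish. *)
have [j wj] : exists j, w j 0 != 0.
  apply/existsP; apply: contraLR uM.
  rewrite negb_exists => /forallP w0.
  have -> : w = 0.
    apply/matrixP => i j; rewrite ord1 [RHS]mxE.
    by apply/eqP/negbNE/w0.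
  by rewrite unitmxE det_ublock1 c0 mul0r unitr0.
(* Adding row [j] of the lower blocks to the first row makes [w j 0] the pivot; the shear by [- e]
   undoes this. *)
pose e : 'rV[R]_n := delta_mx 0 j.
have ewj : (e *m w) 0 0 = w j 0 by rewrite -rowE mxE.
have ME' : (block_mx (c%:M : 'M[R]_1) r w D : 'M[R]_n.+1) =
  block_mx (1%:M : 'M[R]_1) (- e) 0 1%:M *m
   block_mx (((e *m w) 0 0)%:M : 'M[R]_1) (r + e *m D) w D.
  have Ne : (- e *m w) 0 0 = - (e *m w) 0 0 by rewrite mulNmx mxE.
  rewrite mul_block1 Ne mul1r subrr c0 scale1r mulNmx addrK.
  by rewrite scaler0 add0r mul1mx mul0mx add0r mul1mx.
have uM' : (block_mx (((e *m w) 0 0)%:M : 'M[R]_1) (r + e *m D) w D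
    : 'M[R]_n.+1) \in unitmx.
  by move: uM; rewrite {1}ME' unitmx_mul => /andP[].
have := affine_change_comp (affine_change_ushear (- e))
  (affine_change_pivot IH _ uM').
by rewrite -ME' mulmx0 addr0 ewj; exact.
Qed.
End affine_change_of_variables.

(** * Integration against a measure given by a density *)

Section density.
Local Open Scope ereal_scope.
Context d (T : measurableType d) (R : realType).
Variables (mu nu : {measure set T -> \bar R}) (f : T -> R).
Hypothesis mf : measurable_fun setT f.
Hypothesis f0 : forall x, (0 <= f x)%R.
Hypothesis nuE : forall A, measurable A -> nu A = \int[mu]_(x in A) (f x)%:E.

Import HBNNSimple.

(** A simple function is constant on each of its finitely many level sets, where [nuE] applies. *)
Lemma integral_density_nnsfun (h : {nnsfun T >-> R}) :
  \int[nu]_x (h x)%:E = \int[mu]_x ((h x)%:E * (f x)%:E).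
Proof.
have mEf : measurable_fun setT (EFin \o f) by exact/measurable_EFinP.
have mhr r : measurable (h @^-1` [set r]) by exact: measurable_sfunP.
rewrite integralT_nnsfun sintegralE.
transitivity (\int[mu]_x (\sum_(r \in range h)
    r%:E * ((EFin \o f) \_ (h @^-1` [set r])) x)).
  rewrite ge0_integral_fsum//; last 2 first.
  - move=> r; apply: measurable_funeM.
    by apply/(measurable_restrictT _ _).1 => //; exact: measurable_funTS.
  - move=> r x _.
    rewrite patchE; case: ifPn => [|_]; last by rewrite mule0.
    by rewrite inE => <-; rewrite mule_ge0// lee_fin.
  apply: eq_fsbigr => r /[!inE] -[x _ <-].
  rewrite ge0_integralZl//; last 3 first.
  - by apply/(measurable_restrictT _ _).1 => //; exact: measurable_funTS.
  - by move=> y _; rewrite patchE; case: ifPn => // _; rewrite lee_fin.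
  - by rewrite lee_fin.
  by rewrite nuE// integral_mkcond.
apply: eq_integral => x _.
(* At [x], only the value [r = h x] contributes to the sum. *)
rewrite (fsbigD1 (h x))//=; last by exists x.
rewrite patchE mem_set// fsbig1 ?adde0// => r [_ rhx].
by rewrite patchE memNset ?mule0//= => hxr; apply: rhx; rewrite /= hxr.
Qed.

(** Monotone convergence on both sides along increasing simple approximations of [g]. *)
Lemma ge0_integral_density (g : T -> \bar R) :
  measurable_fun setT g -> (forall x, 0 <= g x) ->
  \int[nu]_x g x = \int[mu]_x (g x * (f x)%:E).
Proof.
move=> mg g0; pose h := nnsfun_approx measurableT mg.
have hg x : EFin \o h ^~ x @ \oo --> g x by exact: cvg_nnsfun_approx.
transitivity (limn (fun n => \int[nu]_x (h n x)%:E)).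
  rewrite -monotone_convergence//.
  - by apply: eq_integral => x _; apply/esym/cvg_lim => //; exact: hg.
  - by move=> n; exact/measurable_EFinP.
  - by move=> n x _; rewrite lee_fin.
  - by move=> x _ m n mn; rewrite lee_fin; exact/lefP/nd_nnsfun_approx.
under eq_fun do rewrite integral_density_nnsfun.
rewrite -monotone_convergence//.
- apply: eq_integral => x _; apply/cvg_lim => //.
  by apply: cvgeZr => //; exact: hg.
- by move=> n; apply: emeasurable_funM; exact/measurable_EFinP.
- by move=> n x _; rewrite mule_ge0// lee_fin.
- move=> x _ m n mn; rewrite lee_wpmul2r// lee_fin//.
  exact/lefP/nd_nnsfun_approx.
Qed.

End density.

(** * Positive definite matrices, and Gaussian laws under affine maps *)

Lemma posdefmx_unitmx (R : realType) n (S : 'M[R]_n) :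
  posdefmx S -> S \in unitmx.
Proof.
(* A nonzero row vector in the left kernel would make the quadratic form vanish. *)
move=> [_ Spos]; rewrite -row_free_unit -kermx_eq0.
apply/negPn/negP => /rowV0Pn[z /sub_kermxP zS z0].
have /Spos : z^T != 0 by rewrite trmx_eq0.
by rewrite trmxK zS mul0mx mxE ltxx.
Qed.

Section gaussian.
Context (R : realType) (n : nat).
Implicit Types (mu b z : 'cV[R]_n) (S M : 'M[R]_n).

Lemma measurable_gauss_pdf mu S : measurable_fun setT (gauss_pdf mu S).
Proof.
apply: measurable_funM => //; apply: measurableT_comp => //.
apply: measurable_funM => //; apply: measurableT_comp => //.
under eq_fun do rewrite mxE.
have mz l : measurable_fun setT (fun z => (z - mu) l 0).
  under eq_fun do rewrite mxE.
  by apply: measurable_funD => //; exact: measurable_mx_coord.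
apply: measurable_sum => j; apply: measurable_funM => //.
under eq_fun do rewrite mxE.
apply: measurable_sum => l; apply: measurable_funM => //.
rewrite (_ : (fun z => _) = fun z => (z - mu) l 0)//.
by apply/funext => z; rewrite mxE.
Qed.

Lemma gauss_pdf_ge0 mu S z : 0 <= gauss_pdf mu S z.
Proof. by rewrite mulr_ge0 ?invr_ge0 ?sqrtr_ge0 ?expR_ge0. Qed.

Lemma invmx_congr M S : M \in unitmx -> S \in unitmx ->
  M^T *m invmx (M *m S *m M^T) *m M = invmx S.
Proof.
move=> uM uS.
have uMSM : M *m S *m M^T \in unitmx by rewrite !unitmx_mul uM uS unitmx_tr.
(* Multiplying on the left by [S] and then by [M] brings [M *m S *m M^T] next to its inverse. *)
rewrite -[RHS]mulmx1 -[LHS](mulKmx uS); congr (_ *m _).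
rewrite -[LHS](mulKmx uM) -[RHS](mulVmx uM); congr (_ *m _).
by rewrite !mulmxA mulmxV// mul1mx.
Qed.

(** The Jacobian cancels the factor [\det M ^+ 2] under the square root, and [invmx_congr] preserves
    the quadratic form. *)
Lemma gauss_pdf_affine mu b S M z : M \in unitmx -> S \in unitmx ->
  `|\det M| * gauss_pdf (M *m mu + b) (M *m S *m M^T) (M *m z + b) =
  gauss_pdf mu S z.
Proof.
move=> uM uS; rewrite /gauss_pdf.
have dM : `|\det M| != 0 by rewrite normr_eq0 -unitfE -unitmxE.
rewrite !det_mulmx det_tr.
rewrite (_ : _ ^+ n * _ = \det M ^+ 2 * ((2 * pi) ^+ n * \det S)); last by ring.
rewrite sqrtrM ?sqr_ge0// sqrtr_sqr invfM !mulrA divff// mul1r.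
have -> : M *m z + b - (M *m mu + b) = M *m (z - mu).
  by rewrite mulmxBr opprD addrACA subrr addr0.
by rewrite trmx_mul -(invmx_congr uM uS) !mulmxA.
Qed.

Lemma gauss_law_affine mu b S M (A : set 'cV[R]_n) :
  M \in unitmx -> S \in unitmx -> measurable A ->
  gauss_law (M *m mu + b) (M *m S *m M^T) A =
  gauss_law mu S ((fun z => M *m z + b) @^-1` A).
Proof.
move=> uM uS mA; rewrite /gauss_law integral_mkcond [RHS]integral_mkcond.
have mp := measurable_gauss_pdf (M *m mu + b) (M *m S *m M^T).
have mpA : measurable_fun setT
    ((EFin \o gauss_pdf (M *m mu + b) (M *m S *m M^T)) \_ A).
  apply/(measurable_restrictT _ _).1 => //; apply: measurable_funTS.
  exact/measurable_EFinP.
have pA0 z :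
    (0 <= ((EFin \o gauss_pdf (M *m mu + b) (M *m S *m M^T)) \_ A) z)%E.
  by rewrite patchE; case: ifP => // _; rewrite lee_fin gauss_pdf_ge0.
rewrite (affine_change_unitmx b uM mpA pA0) -ge0_integralZl//; last first.
  by apply: measurableT_comp => //; exact: measurable_affine.
apply: eq_integral => z _; rewrite !patchE.
rewrite (_ : (z \in _ @^-1` A) = (M *m z + b \in A)); last first.
  by apply/idP/idP; rewrite !inE.
by case: ifP => _; rewrite ?mule0// -EFinM gauss_pdf_affine.
Qed.

End gaussian.

(** * Mixture densities and posterior weights *)

Section mixture.
Context (R : realType) (n k : nat) (alpha : 'I_k -> R).
Variables (mu : 'I_k -> 'cV[R]_n) (S : 'I_k -> 'M[R]_n).
Hypothesis alpha_ge0 : forall i, 0 <= alpha i.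

Definition gmm_pdf (z : 'cV[R]_n) : R :=
  \sum_(l < k) alpha l * gauss_pdf (mu l) (S l) z.

Let term_ge0 l z : 0 <= alpha l * gauss_pdf (mu l) (S l) z.
Proof. by rewrite mulr_ge0// gauss_pdf_ge0. Qed.

Let measurable_term l : measurable_fun setT
  (fun z => alpha l * gauss_pdf (mu l) (S l) z).
Proof. by apply: measurable_funM => //; exact: measurable_gauss_pdf. Qed.

Lemma gmm_pdf_ge0 z : 0 <= gmm_pdf z.
Proof. exact: sumr_ge0. Qed.

Lemma measurable_gmm_pdf : measurable_fun setT gmm_pdf.
Proof. exact: measurable_sum. Qed.

Lemma gmmE (A : set 'cV[R]_n) : measurable A ->
  gmm alpha mu S A = (\int[lebesgue_cV n]_(z in A) (gmm_pdf z)%:E)%E.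
Proof.
move=> mA; under [RHS]eq_integral do rewrite -sumEFin.
rewrite ge0_integral_sum//; last 2 first.
- by move=> l; apply/measurable_EFinP/measurable_funTS.
- by move=> l z _; rewrite lee_fin.
apply: eq_bigr => i _; rewrite -ge0_integralZl//.
- by apply/measurable_EFinP/measurable_funTS; exact: measurable_gauss_pdf.
- by move=> z _; rewrite lee_fin gauss_pdf_ge0.
- by rewrite lee_fin.
Qed.

Lemma gmm_posterior_ge0 i z : 0 <= gmm_posterior alpha mu S i z.
Proof. by rewrite divr_ge0 ?sumr_ge0. Qed.

Lemma measurable_gmm_posterior i :
  measurable_fun setT (gmm_posterior alpha mu S i).
Proof.
apply: measurable_funM => //.
(* Inverse and power [-1] agree on nonnegative reals, even at 0, where both are 0. *)
rewrite (_ : (fun z => _) = fun z => gmm_pdf z `^ (-1)).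
  exact: (measurableT_comp (measurable_powR _) measurable_gmm_pdf).
by apply/funext => z; rewrite powR_inv1// gmm_pdf_ge0.
Qed.

(* The junk value of the posterior where the mixture density vanishes is
   harmless: every summand of the density vanishes there too. *)
Lemma gmm_posteriorK i z :
  gmm_posterior alpha mu S i z * gmm_pdf z = alpha i * gauss_pdf (mu i) (S i) z.
Proof.
have [z0|z0] := eqVneq (gmm_pdf z) 0; last by rewrite /gmm_posterior divfK.
rewrite z0 mulr0; move/eqP: z0; rewrite /gmm_pdf psumr_eq0// => /allP/(_ i).
by rewrite mem_index_enum => /(_ isT)/eqP.
Qed.

(** Passing to Lebesgue measure multiplies the posterior by [gmm_pdf], which leaves the [i]-th
    weighted Gaussian density. *)
Lemma integral_gmm_posterior (nu : {measure set 'cV[R]_n -> \bar R}) i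
    (C : set 'cV[R]_n) : measurable C ->
  (forall A, measurable A -> nu A = gmm alpha mu S A) ->
  (\int[nu]_(z in C) (gmm_posterior alpha mu S i z)%:E =
   (alpha i)%:E * gauss_law (mu i) (S i) C)%E.
Proof.
move=> mC nuE; rewrite integral_mkcond.
rewrite (@ge0_integral_density _ _ _ (lebesgue_cV n) nu gmm_pdf)//; first last.
- move=> z; rewrite patchE; case: ifP => // _; rewrite lee_fin.
  exact: gmm_posterior_ge0.
- apply/(measurable_restrictT _ _).1 => //.
  apply: measurable_funTS; apply/measurable_EFinP.
  exact: measurable_gmm_posterior.
- by move=> A mA; rewrite nuE// gmmE.
- exact: gmm_pdf_ge0.
- exact: measurable_gmm_pdf.
rewrite /gauss_law -ge0_integralZl//; last 3 first.
- by apply/measurable_EFinP/measurable_funTS; exact: measurable_gauss_pdf.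
- by move=> z _; rewrite lee_fin gauss_pdf_ge0.
- by rewrite lee_fin.
rewrite [RHS]integral_mkcond; apply: eq_integral => z _; rewrite !patchE.
by case: ifP => _; rewrite ?mul0e// -EFinM gmm_posteriorK.
Qed.

End mixture.

(** * Propagation of the mixture law by induction on time *)

Theorem proposition1 (R : realType) (d m N k : nat)
  (d_gt0 : (0 < d)%N) (m_gt0 : (0 < m)%N) (N_gt0 : (0 < N)%N) (k_gt0 : (0 < k)%N)
  (A : 'M[R]_d) (B : 'M[R]_(d, m))
  (alpha : 'I_k -> R)
  (alpha_ge0 : forall i, 0 <= alpha i) (alpha_sum1 : \sum_(i < k) alpha i = 1)
  (v : nat -> 'I_k -> 'cV[R]_m) (K : nat -> 'I_k -> 'M[R]_(m, d))
  (mu : nat -> 'I_k -> 'cV[R]_d) (Sigma : nat -> 'I_k -> 'M[R]_d)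
  (muS : forall t i, (t < N)%N -> mu t.+1 i = A *m mu t i + B *m v t i)
  (SigmaS : forall t i, (t < N)%N ->
     Sigma t.+1 i = (A + B *m K t i) *m Sigma t i *m (A + B *m K t i)^T)
  (Sigma_posdef : forall t i, (t < N)%N -> posdefmx (Sigma t i))
  (dO : measure_display) (Omega : measurableType dO) (P : probability Omega R)
  (x : nat -> {RV P >-> 'cV[R]_d}) (u : nat -> {RV P >-> 'cV[R]_m})
  (idx : nat -> Omega -> 'I_k)
  (x0_law : has_law (x 0%N) (gmm alpha (mu 0%N) (Sigma 0%N)))
  (dynamics : forall t w, (t < N)%N -> x t.+1 w = A *m x t w + B *m u t w)
  (idx_measurable : forall t i, (t < N)%N -> measurable [set w | idx t w = i])
  (idx_law : forall t i, (t < N)%N ->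
     is_cond_prob P (history x u t) [set w | idx t w = i]
       (fun w => gmm_posterior alpha (mu t) (Sigma t) i (x t w)))
  (policy : forall t w, (t < N)%N ->
     u t w = v t (idx t w) + K t (idx t w) *m (x t w - mu t (idx t w))) :
  forall t, (t < N)%N -> has_law (x t) (gmm alpha (mu t) (Sigma t)).
Proof.
elim=> [//|t IH tN E mE]; have tN' := ltnW tN.
pose M i := A + B *m K t i.
(* With this offset, the affine map of branch [i] sends [mu t i] to [mu t.+1 i]. *)
pose b i := mu t.+1 i - M i *m mu t i.
pose C i := (fun z => M i *m z + b i) @^-1` E.
have mC i : measurable (C i).
  by rewrite /C -[X in measurable X]setTI; exact: measurable_affine.
have xS w : x t.+1 w = M (idx t w) *m x t w + b (idx t w).
  rewrite dynamics// policy//; set i := idx t w.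
  rewrite /b addrCA -mulmxBr muS// /M mulmxDl mulmxDr -mulmxA mulmxBr.
  rewrite addrACA [A *m mu t i + _]addrC subrK.
  by rewrite addrC.
have SU i : Sigma t i \in unitmx by exact/posdefmx_unitmx/Sigma_posdef.
(* Here [t.+1 < N] is essential: it makes [Sigma t.+1 i], a product with factor [M i], positive
   definite. *)
have MU i : M i \in unitmx.
  have := posdefmx_unitmx (Sigma_posdef _ i tN).
  by rewrite SigmaS// !unitmx_mul => /andP[/andP[]].
have mX i : measurable (x t @^-1` C i) by exact: measurable_funPTI.
pose F i := x t @^-1` C i `&` [set w | idx t w = i].
have mF i : measurable (F i) by apply: measurableI => //; exact: idx_measurable.
have EF : x t.+1 @^-1` E = \big[setU/set0]_(i < k) F i.
  rewrite -bigcup_seq; apply/seteqP; split => [w|w [i _]].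
    move=> xE; exists (idx t w); first by rewrite /= mem_index_enum.
    by split => //; rewrite /C /preimage/= -xS.
  by move=> [/= + idxw]; rewrite /C /preimage/= xS idxw.
rewrite /distribution /pushforward EF measure_semi_additive_ord//.
- apply: eq_bigr => i _.
  (* The history at time [t] includes [x t] itself, so the conditional probability may be integrated
     over this event. *)
  have HC : history x u t (x t @^-1` C i).
    by apply: sub_sigma_algebra; left; exists t, (C i).
  apply: etrans ((idx_law t i tN').2 _ HC) _.
  (* The posterior depends on the outcome only through [x t], so the integral moves to the law of
     [x t], known by induction. *)
  transitivity (\int[distribution P (x t)]_(z in C i)
      (gmm_posterior alpha (mu t) (Sigma t) i z)%:E)%E.
    rewrite ge0_integral_pushforward//.
    - apply: measurable_funTS; apply/measurable_EFinP.
      exact: measurable_gmm_posterior.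
    - by move=> z _; rewrite lee_fin gmm_posterior_ge0.
  have -> := integral_gmm_posterior (nu := distribution P (x t)) alpha_ge0 i
    (mC i) (IH tN').
  have <- := gauss_law_affine (mu t i) (b i) (MU i) (SU i) mE.
  by rewrite -(SigmaS _ _ tN') {1}/b [M i *m _ + _]addrC subrK.
- by move=> i j _ _ [w [[_ /= <-] [_ /= <-]]].
- exact: bigsetU_measurable.
Qed.
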